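(* There is a function $h(c,d,k)$ such that the following holds. Let $c\geq 1$, $d\geq 0$ be integers and $k$ a constant. Let $H=(V,E)$ be a $(c,d)$-hypergraph and let $\gamma\colon E\to[0,1]$ with $\operatorname{weight}(\gamma)\leq k$. Then there exists $\nu\colon E\to[0,1]$ such that $\operatorname{weight}(\nu)\leq k$, $B(\gamma)\subseteq B(\nu)$ and $|\operatorname{support}(\nu)|\leq h(c,d,k)$.
   Context: A hypergraph $H=(V,E)$ consists of a finite set of vertices $V$ and a set $E$ of non-empty subsets of $V$ (edges). $H$ is a $(c,d)$-hypergraph if the intersection of any $c$ distinct edges of $E$ has at most $d$ elements. For $\gamma\colon E\to[0,1]$: $B(\gamma)=\{v\in V\mid \sum_{e\in E,\,v\in e}\gamma(e)\geq 1\}$ (the vertices covered by $\gamma$), $\operatorname{support}(\gamma)=\{e\in E\mid \gamma(e)\neq 0\}$, and $\operatorname{weight}(\gamma)=\sum_{e\in E}\gamma(e)$. *)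

(* Defs.v *)
From HB Require Import structures.
From mathcomp Require Import all_boot all_order all_algebra.
From mathcomp Require Import reals.

Set Implicit Arguments.
Unset Strict Implicit.
Unset Printing Implicit Defensive.

Import Order.TTheory GRing.Theory Num.Theory.
Local Open Scope ring_scope.

Record hypergraph := Hypergraph {
  vertex : finType;
  edges : {set {set vertex}};
  edges_nonempty : set0 \notin edges
}.

Definition cd_hypergraph (c d : nat) (H : hypergraph) : Prop :=
  forall F : {set {set vertex H}},
    F \subset edges H -> #|F| = c -> (#|\bigcap_(e in F) e| <= d)%N.

Section WeightFunctions.
Variables (R : realType) (H : hypergraph).

(* A function E -> [0,1] is represented by a function on all vertex sets which
   takes values in [0,1] on the edges. Its values off the edges are junk: the
   notions below only look at edges. *)
Definition edge_weighting (g : {set vertex H} -> R) : Prop :=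
  forall e, e \in edges H -> 0 <= g e <= 1.

Definition weight (g : {set vertex H} -> R) : R := \sum_(e in edges H) g e.

Definition covered (g : {set vertex H} -> R) : {set vertex H} :=
  [set v | 1 <= \sum_(e in edges H | v \in e) g e].

Definition weight_support (g : {set vertex H} -> R) : {set {set vertex H}} :=
  [set e in edges H | g e != 0].

End WeightFunctions.

(* Main.v *)
From mathcomp Require Import boolp classical_sets filter topology normedtype.
Require Import Defs.
From HB Require Import structures.
From mathcomp Require Import all_boot all_order all_algebra.
From mathcomp Require Import reals lra.

Set Implicit Arguments.
Unset Strict Implicit.
Unset Printing Implicit Defensive.

Import Order.TTheory GRing.Theory Num.Theory.
Import numFieldNormedType.Exports.
Local Open Scope ring_scope.

(**
  By compactness.  Suppose some weightings of weight at most [k] on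
  (c,d)-hypergraphs need larger and larger supports.  List the weights of each
  one in decreasing order and let [a] be a cluster point of these sequences in
  [[0, 1]^nat].  Since [a] tends to 0, the sums of fewer than [c] terms of [a]
  that are below 1 stay below [1 - delta].

  Call the first [m] edges heavy.  A covered vertex lying in at least [c] heavy
  edges is one of at most [2^m * d]; one whose heavy edges have [a]-sum below 1
  receives light weight at least [delta / 2], and double counting bounds the
  number of these as well.  The remaining covered vertices are almost covered by
  their heavy edges.  Hence it suffices to keep the heavy edges and one edge for
  each trace of a light edge on a vertex set of bounded size.  This is a
  covering problem with boundedly many variables, so it is one of finitely many
  systems, and its solutions lie in a compact cube: a solution that is close
  enough to feasible can be replaced by an exact one of weight at most [k].
*)

(** * Cluster points, gaps of sums and double counting *)

(** Tychonoff gives a cluster point in the product topology. A neighbourhood there constrains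
    finitely many coordinates, whence the list [s]. *)
Lemma unit_cube_cluster (R : realType) (I : eqType) (x : nat -> I -> R) :
    (forall n i, 0 <= x n i <= 1) ->
  exists a : I -> R, (forall i, 0 <= a i <= 1) /\
    forall (s : seq I) (eps : R) (N : nat), 0 < eps ->
      exists n, (N <= n)%N /\ forall i, i \in s -> `|x n i - a i| < eps.
Proof.
move=> x01.
have [] := @tychonoff I (fun=> R) _ (fun=> @segment_compact R 0 1)
  (nbhs (x @ \oo)%classic) _ _.
  by exists 0%N => // n _ i; rewrite /= in_itv; exact: x01.
move=> a [/= a01 acl]; exists a; split=> [i|s eps N eps0].
  by have := a01 i; rewrite /= in_itv.
have nA : nbhs (x @ \oo)%classic
    (fun f : I -> R => exists2 n, (N <= n)%N & f = x n).
  by exists N => // n /= Nn; exists n.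
have nB : nbhs a (fun f : I -> R => forall i, i \in s -> `|f i - a i| < eps).
  elim: s => [|j s IHs]; first by apply: filterE.
  have nj : nbhs a (fun f : I -> R => `|f j - a j| < eps).
    have := @proj_continuous I (fun=> R) j a
       (fun r => `|r - a j| < eps); apply.
    by apply/nbhs_ballP; exists eps => //= r; rewrite /ball /= distrC.
  apply: filterS2 nj IHs => f fj fs i; rewrite inE => /predU1P[->//|/fs//].
by have [_ [[n nN ->]] fs] := acl _ _ nA nB; exists n.
Qed.

(** Induction on [r]. Either all indices are at least [M], and the terms are so small that they sum
    to at most [D / 2], or some [i < M] occurs. Removing [a i] leaves a shorter sum with threshold
    [D - a i], and there are finitely many such [i]. *)
Lemma bounded_sums_gap (R : realFieldType) (a : nat -> R) (r : nat) (D : R) :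
    (forall i, 0 <= a i) ->
    (forall e, 0 < e -> exists M, forall i, (M <= i)%N -> a i <= e) -> 0 < D ->
  exists2 delta, 0 < delta & forall s : seq nat, (size s <= r)%N ->
    \sum_(i <- s) a i < D -> \sum_(i <- s) a i <= D - delta.
Proof.
move=> a0 acvg; elim: r D => [|r IHr] D D0.
  by exists D => // -[|//] _; rewrite big_nil subrr.
have r0 : 0 < r.+1%:R :> R by rewrite ltr0n.
have [M aM] := acvg (D / 2 / r.+1%:R) ltac:(by rewrite !divr_gt0).
have [delta d0 dP] : exists2 delta, 0 < delta & forall i, (i < M)%N ->
    a i < D -> forall s : seq nat, (size s <= r)%N ->
    \sum_(j <- s) a j < D - a i -> \sum_(j <- s) a j <= D - a i - delta.
  elim: M {aM} => [|M [d1 d10 d1P]]; first by exists 1.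
  have [aD|Da] := ltP (a M) D; last first.
    exists d1 => // i; rewrite ltnS leq_eqVlt => /predU1P[->|]; last exact: d1P.
    by rewrite ltNge Da.
  have [|d2 d20 d2P] := IHr (D - a M); first by rewrite subr_gt0.
  exists (Num.min d1 d2); first by rewrite lt_min d10.
  move=> i; rewrite ltnS leq_eqVlt => /predU1P[->|iM] aiD s sr sD.
    by apply: le_trans (d2P _ sr sD) _; rewrite lerD2l lerN2 ge_min lexx orbT.
  by apply: le_trans (d1P _ iM aiD s sr sD) _; rewrite lerD2l lerN2 ge_min lexx.
exists (Num.min delta (D / 2)); first by rewrite lt_min d0 divr_gt0.
move=> s sr sD; have [/hasP[i si iM]|/hasPn sM] := boolP (has (ltn^~ M) s).
  rewrite (big_rem i) //= in sD *.
  have s0 : 0 <= \sum_(j <- rem i s) a j by apply: sumr_ge0 => j _.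
  have := dP i iM _ (rem i s) _ _; rewrite size_rem //.
  have srr : ((size s).-1 <= r)%N by case: (size s) sr.
  have m1 : Num.min delta (D / 2) <= delta by rewrite ge_min lexx.
  by move=> /(_ _ srr); lra.
apply: (@le_trans _ _ (D / 2)); last first.
  have : Num.min delta (D / 2) <= D / 2 by rewrite ge_min lexx orbT.
  lra.
have: \sum_(i <- s) a i <= \sum_(i <- s) (D / 2 / r.+1%:R).
  rewrite !big_seq; apply: ler_sum => i /sM; rewrite -leqNgt; exact: aM.
move/le_trans; apply; rewrite big_const_seq count_predT iter_addr_0.
rewrite -[leRHS](@divfK _ r.+1%:R) ?gt_eqF// -[leLHS]mulr_natr.
by rewrite ler_wpM2l ?ler_nat// !divr_ge0// ltW.
Qed.

(* Double counting: [\sum_(v in X) w(v) = \sum_e w(e) #|e :&: X|], and deleting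
   one edge [e] lowers the intersection parameter on [e :&: X] by one. *)
Lemma card_light_covered (R : realFieldType) (T : finType) (w : {set T} -> R)
    (s k D : R) (d r : nat) (E : {set {set T}}) (X : {set T}) :
    0 <= s -> 0 < D ->
    (forall e, e \in E -> 0 <= w e <= s) -> \sum_(e in E) w e <= k ->
    (forall F : {set {set T}}, F \subset E -> #|F| = r ->
       (#|X :&: \bigcap_(e in F) e| <= d)%N) ->
    (forall v, v \in X -> D + r%:R * s <= \sum_(e in E | v \in e) w e) ->
  #|X|%:R <= d%:R * (k / D) ^+ r.
Proof.
move=> s0 D0; elim: r E X => [|r IHr] E X wE Ek EX XD.
  (* For [r = 0] the empty family has full intersection, so [X] itself has at most [d] elements. *)
  have := EX set0 (sub0set _) (cards0 _).
  by rewrite big_set0 setIT expr0 mulr1 ler_nat.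
have w0 e : e \in E -> 0 <= w e by case/wE/andP.
have k0 : 0 <= k by apply: le_trans Ek; apply: sumr_ge0.
have cardX e : e \in E -> #|X :&: e|%:R <= d%:R * (k / D) ^+ r.
  move=> Ee; apply: (IHr (E :\ e)) => [f||F FE Fr|v].
  - by rewrite in_setD1 => /andP[_ /wE].
  - by apply: le_trans Ek; rewrite [leRHS](big_setD1 e)//= lerDr w0.
  - have eF : e \notin F by apply/negP => /(subsetP FE); rewrite !inE eqxx.
    have := EX (e |: F); rewrite big_setU1//= setIA; apply.
      by rewrite subUset sub1set Ee (subset_trans FE)// subsetDl.
    by rewrite cardsU1 eF Fr.
  rewrite in_setI => /andP[/XD vD ve].
  move: vD; rewrite (bigD1 e) ?Ee//=.
  rewrite (eq_bigl (fun f => (f \in E :\ e) && (v \in f))); last first.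
    by move=> f; rewrite !inE; case: (f == e) => //=; rewrite ?andbF ?andbT.
  (* Deleting [e] costs at most [s], exactly the drop of the threshold from [r.+1] to [r]. *)
  have /andP[_ es] := wE e Ee.
  by rewrite -natr1 mulrDl mul1r; lra.
have XkD : #|X|%:R * D <= k * (d%:R * (k / D) ^+ r).
  apply: (@le_trans _ _ (\sum_(v in X) \sum_(e in E | v \in e) w e)).
    rewrite mulr_natl -sumr_const; apply: ler_sum => v /XD.
    by apply: le_trans; rewrite lerDl mulr_ge0.
  rewrite (exchange_big_dep (mem E)) /=; last by move=> v e _ /andP[].
  apply: (@le_trans _ _ (\sum_(e in E) w e * (d%:R * (k / D) ^+ r))).
    apply: ler_sum => e Ee; rewrite (eq_bigl (mem (X :&: e))); last first.
      by move=> v; rewrite !inE Ee.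
    by rewrite sumr_const -[leLHS]mulr_natr ler_wpM2l ?w0 ?cardX.
  by rewrite -mulr_suml ler_wpM2r// mulr_ge0// exprn_ge0// divr_ge0// ltW.
by rewrite exprS mulrCA -(ler_pM2r D0) (le_trans XkD)// mulrAC divfK// gt_eqF.
Qed.

(** * Covering systems over a fixed finite set of variables *)

Lemma ler_sum_subset (R : numDomainType) (I : finType) (P Q : pred I)
    (F : I -> R) :
    (forall i, P i -> Q i) -> (forall i, Q i -> 0 <= F i) ->
  \sum_(i | P i) F i <= \sum_(i | Q i) F i.
Proof.
move=> PQ F0; rewrite big_mkcond [leRHS]big_mkcond /=; apply: ler_sum => i _.
by case: ifP => [/PQ ->//|_]; case: ifP => // /F0.
Qed.

Lemma ler_dist_sum_card (R : realDomainType) (I : finType) (A : {set I})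
    (F G : I -> R) (eps : R) :
    (forall i, i \in A -> `|F i - G i| <= eps) ->
  `|\sum_(i in A) F i - \sum_(i in A) G i| <= #|A|%:R * eps.
Proof.
move=> FG; rewrite -sumrB (le_trans (ler_norm_sum _ _ _))//.
by rewrite mulr_natl -sumr_const; apply: ler_sum.
Qed.

Lemma nat_inv_le (R : realType) (e : R) : 0 < e ->
  exists N, forall n, (N <= n)%N -> n.+1%:R^-1 <= e.
Proof.
move=> /ltr_add_invr[N]; rewrite add0r => Ne; exists N => n Nn.
by apply: le_trans (ltW Ne); rewrite lef_pV2 ?posrE ?ltr0n// ler_nat.
Qed.

(* The feasible region is compact, so if no point of weight at most [k] solves
   the covering system then none solves a slight relaxation of it. *)
Lemma covering_gap1 (R : realType) (J : finType) (k : R) (CC : {set {set J}}) :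
  exists2 eta, 0 < eta & forall y : J -> R, (forall j, 0 <= y j <= 1) ->
    \sum_j y j <= k ->
    (forall C, C \in CC -> 1 - eta <= \sum_(j in C) y j) ->
  exists z : J -> R, [/\ forall j, 0 <= z j <= 1, \sum_j z j <= k
    & forall C, C \in CC -> 1 <= \sum_(j in C) z j].
Proof.
apply: contrapT => nex.
have /choice[y yP] : forall n : nat, exists y : J -> R,
    [/\ forall j, 0 <= y j <= 1, \sum_j y j <= k
      & forall C, C \in CC -> 1 - n.+1%:R^-1 <= \sum_(j in C) y j].
  move=> n; apply: contrapT => ny; apply: nex.
  exists n.+1%:R^-1; first by rewrite invr_gt0 ltr0n.
  by move=> y y1 y2 y3; exfalso; apply: ny; exists y.
have [|a [a01 ya]] := @unit_cube_cluster R J y; first by move=> n; case: (yP n).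
have approx e (C : {set J}) : 0 < e -> exists n, n.+1%:R^-1 <= e /\
    `|\sum_(j in C) y n j - \sum_(j in C) a j| <= e.
  move=> e0; have [N Ne] := nat_inv_le e0.
  have J0 : 0 < #|J|.+1%:R :> R by rewrite ltr0n.
  have [|n [Nn yan]] := ya (enum J) (e / #|J|.+1%:R) N; first exact: divr_gt0.
  exists n; split; first exact: Ne.
  apply: le_trans (ler_dist_sum_card (eps := e / #|J|.+1%:R) _) _.
    by move=> j _; apply: ltW; apply: yan; rewrite mem_enum.
  rewrite -[leRHS](@divfK _ #|J|.+1%:R) ?gt_eqF// mulrC ler_wpM2l ?ler_nat//.
    by rewrite ltW ?divr_gt0.
  by apply: leqW; apply: max_card.
(* The cluster point [a] solves the system exactly, so it serves as [z] for every [y], and any gap,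
   here [1], contradicts [nex]. *)
apply: nex; exists 1 => // _ _ _ _; exists a; split=> // [|C CCC].
  apply/ler_addgt0Pr => e e0; have [n [_]] := approx e setT e0.
  have sumT (f : J -> R) : \sum_(j in setT) f j = \sum_j f j.
    by apply: eq_bigl => j; rewrite inE.
  rewrite !sumT ler_norml => /andP[h _]; have [_ + _] := yP n; lra.
apply/ler_addgt0Pr => e e0; have [|n [ne]] := approx (e / 2) C.
  by rewrite divr_gt0.
rewrite ler_norml => /andP[_ h]; have [_ _ /(_ C CCC)] := yP n.
by move: n.+1%:R^-1 ne => q; lra.
Qed.

(** The gap must not depend on the system: a finite [J] admits finitely many families [CC], and the
    least of their gaps serves all. *)
Lemma covering_gap (R : realType) (J : finType) (k : R) :
  exists2 eta, 0 < eta & forall (CC : {set {set J}}) (y : J -> R),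
    (forall j, 0 <= y j <= 1) -> \sum_j y j <= k ->
    (forall C, C \in CC -> 1 - eta <= \sum_(j in C) y j) ->
  exists z : J -> R, [/\ forall j, 0 <= z j <= 1, \sum_j z j <= k
    & forall C, C \in CC -> 1 <= \sum_(j in C) z j].
Proof.
have /choice[f fP] : forall CC : {set {set J}}, exists eta : R, 0 < eta /\
    forall y : J -> R, (forall j, 0 <= y j <= 1) -> \sum_j y j <= k ->
    (forall C, C \in CC -> 1 - eta <= \sum_(j in C) y j) ->
  exists z : J -> R, [/\ forall j, 0 <= z j <= 1, \sum_j z j <= k
    & forall C, C \in CC -> 1 <= \sum_(j in C) z j].
  by move=> CC; have [eta] := covering_gap1 k CC; exists eta.
exists (\big[Num.min/1]_CC f CC).
  by apply: lt_bigmin => // CC _; case: (fP CC).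
move=> CC y y01 yk yC; have [_ fC] := fP CC; apply: (fC y) => // C /yC.
by apply: le_trans; rewrite lerD2l lerN2 bigmin_le.
Qed.

(** * Merging edges into classes *)

(** The value [y j] is placed on a single edge of class [j], if there is one. This edge may lie
    outside [A], so every edge whose class meets [A] is required to contain [v]. *)
Lemma class_representatives (R : realDomainType) (T J : finType)
    (E : {set {set T}}) (phi : {set T} -> J) (y : J -> R) :
    (forall j, 0 <= y j <= 1) ->
  exists nu : {set T} -> R,
    [/\ forall e, 0 <= nu e <= 1,
        \sum_(e in E) nu e <= \sum_j y j,
        (#|[set e in E | nu e != 0%R]| <= #|J|)%N
      & forall v (A : {set {set T}}), A \subset E ->
          (forall e, e \in E -> phi e \in phi @: A -> v \in e) ->
          \sum_(j in phi @: A) y j <= \sum_(e in E | v \in e) nu e].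
Proof.
move=> y01.
pose rep j := odflt set0 [pick e in E | phi e == j].
pose S := [set e in E | rep (phi e) == e].
have repP e : e \in E -> rep (phi e) \in S /\ phi (rep (phi e)) = phi e.
  move=> Ee; have : rep (phi e) \in E /\ phi (rep (phi e)) = phi e.
    rewrite /rep; case: pickP => [f /andP[Ef /eqP <-]//|/(_ e)].
    by rewrite Ee eqxx.
  by case=> Er pr; rewrite inE Er pr eqxx.
have phi_inj : {in S &, injective phi}.
  by move=> e f; rewrite !inE => /andP[_ /eqP{2}<-] /andP[_ /eqP{2}<-] ->.
pose nu e := if e \in S then y (phi e) else 0.
have nu01 e : 0 <= nu e <= 1 by rewrite /nu; case: ifP => _; rewrite ?lexx ?ler01.
have sumS (A : {set {set T}}) : A \subset S ->
    \sum_(e in A) nu e = \sum_(j in phi @: A) y j.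
  move=> AS; rewrite big_imset /=; last first.
    by move=> e f /(subsetP AS) eS /(subsetP AS) fS; apply: phi_inj.
  by apply: eq_bigr => e /(subsetP AS); rewrite /nu => ->.
have SE : S \subset E by apply/subsetP => e; rewrite inE => /andP[].
exists nu; split=> //.
- rewrite (big_setID S) /= [X in _ + X]big1 ?addr0; last first.
    by move=> e; rewrite inE /nu => /andP[/negbTE->].
  rewrite sumS ?subsetIr//.
  by apply: ler_sum_subset => // j _; case/andP: (y01 j).
- apply: (@leq_trans #|S|); last first.
    by rewrite -(card_in_imset phi_inj) max_card.
  apply/subset_leq_card/subsetP => e; rewrite !inE /nu.
  by case: ifP; rewrite ?inE ?eqxx ?andbF.
- move=> v A AE vA.
  have -> : phi @: A = phi @: [set e in S | phi e \in phi @: A].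
    apply/setP => j; apply/imsetP/imsetP => -[e]; last first.
      by rewrite inE => /andP[_ /imsetP[f fA ->]] ->; exists f.
    move=> eA ->; have [rS rp] := repP e (subsetP AE e eA).
    by exists (rep (phi e)); rewrite // inE rS rp imset_f.
  rewrite -sumS; last by apply/subsetP => e; rewrite inE => /andP[].
  apply: ler_sum_subset => [e|e _]; last by case/andP: (nu01 e).
  by rewrite inE => /andP[eS /vA ->]; rewrite (subsetP SE).
Qed.

(* Merging each class of [phi] into one representative edge turns the covering
   problem into one on [J], whose size is under control. *)
Lemma merge_classes (R : realType) (J : finType) (k : R) :
  exists2 eta, 0 < eta &
    forall (T : finType) (E : {set {set T}}) (g : {set T} -> R)
      (phi : {set T} -> J) (B : {set T}) (A : T -> {set {set T}}),
    (forall e, e \in E -> 0 <= g e) -> \sum_(e in E) g e <= k ->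
    (forall v, v \in B -> [/\ A v \subset E,
       forall e f, e \in A v -> f \in E -> phi e = phi f -> f \in A v,
       forall e, e \in A v -> v \in e
       & 1 - eta <= \sum_(e in A v) g e]) ->
  exists nu : {set T} -> R,
    [/\ forall e, 0 <= nu e <= 1,
        \sum_(e in E) nu e <= k,
        forall v, v \in B -> 1 <= \sum_(e in E | v \in e) nu e
      & (#|[set e in E | nu e != 0%R]| <= #|J|)%N].
Proof.
have [eta eta0 etaP] := covering_gap J k; exists eta => //.
move=> T E g phi B A g0 gk AP.
pose c j := \sum_(e in E | phi e == j) g e.
have c0 j : 0 <= c j by apply: sumr_ge0 => e /andP[/g0].
pose y j := Num.min 1 (c j).
have y0 j : 0 <= y j by rewrite le_min ler01 c0.
have [||C /imsetP[v vB ->]|z [z01 zk zC]] := etaP [set phi @: A v | v in B] y.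
- by move=> j; rewrite y0 ge_min lexx.
- apply: le_trans gk; rewrite [leRHS](partition_big phi predT)//=.
  by apply: ler_sum => j _; rewrite ge_min lexx orbT.
- have [AE _ _ Ag] := AP v vB.
  (* A class of total weight at least 1 covers [v] alone; if none meets [A v], the truncation in [y]
     changes nothing there. *)
  have [/exists_inP[j jA cj]|/exists_inPn nc] :=
      boolP [exists j in phi @: A v, 1 <= c j].
    rewrite (bigD1 j)//= {1}/y (min_idPl cj).
    have : 0 <= \sum_(i in phi @: A v | i != j) y i by apply: sumr_ge0.
    lra.
  apply: le_trans Ag _; rewrite (partition_big_imset phi) /=.
  apply: ler_sum => j jA; rewrite /y (min_idPr _); last first.
    by rewrite ltW// ltNge nc.
  apply: ler_sum_subset => e; last by case/andP => /g0.
  by case/andP => /(subsetP AE) -> ->.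
have [nu [nu01 nuE nuS nuC]] := class_representatives E phi z01.
exists nu; split=> // [|v vB]; first exact: le_trans zk.
have [AE Asat Av _] := AP v vB.
apply: le_trans (zC _ (imset_f _ vB)) (nuC _ _ AE _) => f fE.
by case/imsetP => e eA /esym efe; apply: Av; apply: Asat efe.
Qed.

(** * Ranked weights and heavy edges *)

(** Ranking makes weightings of different hypergraphs comparable. In decreasing order the first
    [i.+1] weights are all at least [x i] and sum to at most [k], whence the last bound. *)
Lemma weight_ranking (R : realType) (T : finType) (E : {set {set T}})
    (g : {set T} -> R) (k : R) :
    (forall e, e \in E -> 0 <= g e <= 1) -> \sum_(e in E) g e <= k ->
  exists (idx : {set T} -> nat) (x : nat -> R),
    [/\ {in E &, injective idx}, forall e, e \in E -> x (idx e) = g e,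
        forall i, 0 <= x i <= 1 & forall i, x i * i.+1%:R <= k].
Proof.
move=> g01 gk; pose r : rel {set T} := fun e f => g f <= g e.
pose s := sort r (enum E).
have rtot : total r by move=> e f; apply: le_total.
have rtr : transitive r by move=> f e h ef fh; apply: le_trans fh ef.
have rrefl : reflexive r by move=> e; apply: lexx.
have ss : sorted r s by apply: sort_sorted.
have sE e : (e \in s) = (e \in E) by rewrite mem_sort mem_enum.
have sumE : \sum_(e in E) g e = \sum_(e <- s) g e.
  by rewrite -big_enum; apply: perm_big; rewrite perm_sym perm_sort.
have k0 : 0 <= k by apply: le_trans gk; apply: sumr_ge0 => e /g01 /andP[].
(* The default [0] continues the weights past the last edge, so both bounds hold at every [i]. *)
exists (index^~ s), (fun i => nth 0 (map g s) i); split=> [e f eE fE|e eE|i|i].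
- by move=> /(congr1 (nth set0 s)); rewrite !nth_index ?sE.
- by rewrite (nth_map set0) ?index_mem ?nth_index ?sE.
- have [is_|si] := ltnP i (size s); last first.
    by rewrite nth_default ?size_map// lexx ler01.
  by rewrite (nth_map set0)// g01// -sE mem_nth.
- have [is_|si] := ltnP i (size s); last first.
    by rewrite nth_default ?size_map// mul0r.
  rewrite (nth_map set0)//; apply: le_trans gk; rewrite sumE.
  rewrite -[in leRHS](cat_take_drop i.+1 s) big_cat /=.
  have d0 : 0 <= \sum_(e <- drop i.+1 s) g e.
    by rewrite big_seq; apply: sumr_ge0 => e /mem_drop; rewrite sE => /g01/andP[].
  apply: ler_wpDr => //.
  have <- : \sum_(e <- take i.+1 s) g (nth set0 s i) =
      g (nth set0 s i) * i.+1%:R.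
    rewrite big_const_seq count_predT iter_addr_0 size_takel//.
    by rewrite -[LHS]mulr_natr.
  rewrite !big_seq; apply: ler_sum => e /(nthP set0)[j].
  rewrite size_takel// => ji <-; rewrite nth_take//.
  apply: (sorted_leq_nth rtr rrefl) => //; rewrite inE ltnS in ji *.
  exact: leq_ltn_trans is_.
Qed.

(** [M] depends on [k] and [e] alone, so it serves all ranked sequences and their cluster point
    alike. *)
Lemma rank_bound_small (R : realType) (k e : R) : 0 <= k -> 0 < e ->
  exists M, forall i t, (M <= i)%N -> t * i.+1%:R <= k -> t <= e.
Proof.
move=> k0 e0; have k1 : 0 < k + 1 by rewrite ltr_wpDl.
have [|M MP] := @nat_inv_le R (e / (k + 1)); first exact: divr_gt0.
exists M => i t /MP ie; rewrite -ler_pdivlMr ?ltr0n// => /le_trans; apply.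
apply: (@le_trans _ _ (k * (e / (k + 1)))); first exact: ler_wpM2l.
rewrite mulrCA -[leRHS]mulr1 ler_wpM2l ?(ltW e0)// ler_pdivrMr// mul1r.
by rewrite lerDl.
Qed.

Lemma card_bigcup_le (T I : finType) (P : pred I) (F : I -> {set T}) :
  (#|\bigcup_(i | P i) F i| <= \sum_(i | P i) #|F i|)%N.
Proof.
elim/big_rec2: _ => [|i A n _ An]; first by rewrite cards0.
by apply: leq_trans (leq_card_setU _ _) _; rewrite leq_add2l.
Qed.

(** Each such vertex lies in the intersection of a [c]-element subfamily of [F]; there are at most
    [2 ^ #|F|] of these, each with at most [d] common vertices. *)
Lemma card_multiply_covered (H : hypergraph) (c d : nat)
    (F : {set {set vertex H}}) :
    cd_hypergraph c d H -> F \subset edges H ->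
  (#|[set v | (c <= #|[set e in F | v \in e]|)%N]| <= 2 ^ #|F| * d)%N.
Proof.
move=> cdH FE.
apply: (@leq_trans #|\bigcup_(G in powerset F | #|G| == c) \bigcap_(e in G) e|).
  apply/subset_leq_card/subsetP => v; rewrite inE => cv.
  pose G := [set e in take c (enum [set e in F | v \in e])].
  have GP e : e \in G -> e \in F /\ v \in e.
    by rewrite inE => /mem_take; rewrite mem_enum inE => /andP[].
  apply/bigcupP; exists G; last by apply/bigcapP => e /GP[].
  rewrite powersetE; apply/andP; split; first by apply/subsetP => e /GP[].
  rewrite cardsE (card_uniqP _) ?take_uniq ?enum_uniq//.
  by rewrite size_takel// -cardE.
apply: leq_trans (card_bigcup_le _ _) _.
rewrite -card_powerset -sum_nat_const [leqRHS](bigID (fun G : {set {set vertex H}} => #|G| == c)) /=.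
apply: leq_trans (leq_addr _ _); apply: leq_sum => G /andP[].
rewrite powersetE => GF /eqP Gc; apply: cdH => //; exact: subset_trans FE.
Qed.

Lemma card_rank_lt (T : finType) (E : {set T}) (idx : T -> nat) (m : nat) :
  {in E &, injective idx} -> (#|[set e in E | (idx e < m)%N]| <= m)%N.
Proof.
move=> idx_inj; set S := [set e in E | _].
rewrite cardE -(size_map idx) -[leqRHS](size_iota 0); apply: uniq_leq_size.
  rewrite map_inj_in_uniq ?enum_uniq// => e f.
  by rewrite !mem_enum !inE => /andP[eE _] /andP[fE _]; apply: idx_inj.
by move=> i /mapP[e]; rewrite mem_enum inE mem_iota => /andP[_ ?] ->.
Qed.

(** * The compactness argument *)

Lemma bounded_support (R : realType) (c d : nat) (k : R) :
  exists N, forall H : hypergraph, cd_hypergraph c d H ->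
    forall gamma : {set vertex H} -> R,
      edge_weighting gamma -> weight gamma <= k ->
    exists nu : {set vertex H} -> R,
      [/\ edge_weighting nu, weight nu <= k, covered gamma \subset covered nu
        & (#|weight_support nu| <= N)%N].
Proof.
apply: contrapT => nN.
(* [p n] is a counterexample to the bound [n]; its hypergraph varies with [n], hence the dependent
   pair. *)
have /choice[p pP] : forall n, exists p : {H : hypergraph & {set vertex H} -> R},
    [/\ cd_hypergraph c d (projT1 p), edge_weighting (projT2 p),
        weight (projT2 p) <= k
      & ~ exists nu : {set vertex (projT1 p)} -> R,
      [/\ edge_weighting nu, weight nu <= k,
         covered (projT2 p) \subset covered nu
        & (#|weight_support nu| <= n)%N]].
  move=> n; apply: contrapT => np; apply: nN; exists n => H cdH g gw gk.
  by apply: contrapT => nnu; apply: np; exists (existT _ H g).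
have /choice[x xP] : forall n, exists x : nat -> R,
    exists idx : {set vertex (projT1 (p n))} -> nat,
    [/\ {in edges (projT1 (p n)) &, injective idx},
        forall e, e \in edges (projT1 (p n)) -> x (idx e) = projT2 (p n) e,
        forall i, 0 <= x i <= 1 & forall i, x i * i.+1%:R <= k].
  move=> n; have [_ gw gk _] := pP n.
  by have [idx [x ?]] := weight_ranking gw gk; exists x, idx.
have k0 : 0 <= k.
  have [_ gw gk _] := pP 0%N; apply: le_trans gk.
  by apply: sumr_ge0 => e /gw/andP[].
have [|a [a01 xa]] := @unit_cube_cluster R nat x.
  by move=> n; have [idx []] := xP n.
(* The rank bound passes to [a] coordinate by coordinate and makes [a] tend to 0. *)
have ak i : a i * i.+1%:R <= k.
  apply/ler_addgt0Pr => e e0; have i0 : 0 < i.+1%:R :> R by rewrite ltr0n.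
  have [|n [_ /(_ i)]] := xa [:: i] (e / i.+1%:R) 0%N; first exact: divr_gt0.
  rewrite inE => /(_ (eqxx _)); rewrite ltr_norml => /andP[+ _].
  have [_ [_ _ _ /(_ i)]] := xP n; rewrite -!ler_pdivlMr// mulrDl.
  by move: i.+1%:R^-1 => q; lra.
have [||delta delta0 deltaP] := @bounded_sums_gap R a c 1 _ _ ltr01.
- by move=> i; case/andP: (a01 i).
- move=> e e0; have [M MP] := rank_bound_small k0 e0.
  by exists M => i /MP; apply.
have c0 : 0 < c.+1%:R :> R by rewrite ltr0n.
(* [s] will bound the light weights. A light weight of [delta / 2] pays for the threshold
   [delta / 4] of the double counting and for [c] deletions of an edge. *)
pose s := delta / 4 / c.+1%:R.
have s0 : 0 < s by rewrite !divr_gt0.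
have D0 : 0 < delta / 4 by rewrite divr_gt0.
have Ds : delta / 4 + c%:R * s <= delta / 2.
  have : s * c.+1%:R = delta / 4 by rewrite divfK ?gt_eqF.
  by rewrite -natr1 mulrDr mulr1 mulrC; lra.
have [m mP] := rank_bound_small k0 s0.
(* The summands bound [B1] and [B2] below, the vertices whose traces must be kept. *)
pose P := (2 ^ m * d + Num.bound (d%:R * (k / (delta / 4)) ^+ c))%N.
(* A heavy edge is its own class, named by its rank; a light edge is classified by its trace on at
   most [P] vertices. *)
pose J := ('I_m + {set 'I_P})%type.
have [eta eta0 etaP] := merge_classes J k.
pose mn := Num.min (delta / 2) eta.
have mn0 : 0 < mn by rewrite lt_min eta0 divr_gt0.
have m0 : 0 < m.+1%:R :> R by rewrite ltr0n.
(* [J] and [mn] are fixed before [n], so [n] can be at least [#|J|]: a support of at most [#|J|]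
   edges will then refute the choice of [p n]. Sums of at most [m] heavy weights stay within [mn] of
   their limits. *)
have [|n [nJ xan]] := xa (iota 0 m) (mn / m.+1%:R) #|{: J}|.
  exact: divr_gt0.
have [idx [idx_inj xidx _ xk]] := xP n.
case: (pP n); case: (p n) => H g /= in idx idx_inj xidx * => cdH gw gk; apply.
set E := edges H in idx_inj xidx *.
have g0 e : e \in E -> 0 <= g e by case/gw/andP.
pose Hs := [set e in E | (idx e < m)%N].
pose Hv v := [set e in Hs | v \in e].
have HsE : Hs \subset E by apply/subsetP => e; rewrite inE => /andP[].
have HvS v : Hv v \subset Hs by apply/subsetP => e; rewrite inE => /andP[].
have card_Hs : (#|Hs| <= m)%N by apply: card_rank_lt.
(* The gap [delta] is known only for sums of limit weights, so [B2] is defined through [a] rather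
   than [g]. *)
pose asum v := \sum_(e in Hv v) a (idx e).
have near_asum v : `|\sum_(e in Hv v) g e - asum v| <= mn.
  apply: le_trans (ler_dist_sum_card (eps := mn / m.+1%:R) _) _ => [e|].
    move=> /(subsetP (HvS v)); rewrite inE => /andP[eE em].
    by rewrite -xidx// ltW// xan// mem_iota.
  rewrite -[leRHS](@divfK _ m.+1%:R) ?gt_eqF// mulrC ler_wpM2l//.
    by rewrite ltW ?divr_gt0.
  rewrite ler_nat leqW// (leq_trans _ card_Hs)//; exact: subset_leq_card.
pose B := covered g.
pose B1 := [set v | (c <= #|Hv v|)%N].
pose B2 := [set v in B | (#|Hv v| < c)%N && (asum v < 1)].
have card_B1 : (#|B1| <= 2 ^ m * d)%N.
  apply: leq_trans (card_multiply_covered cdH HsE) _.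
  by rewrite leq_mul2r leq_exp2l// card_Hs orbT.
have card_B2 : #|B2|%:R <= d%:R * (k / (delta / 4)) ^+ c.
  apply: (@card_light_covered R _ g s k _ d c (E :\: Hs)) => //.
  - exact: ltW.
  - move=> e; rewrite !inE => /andP[+ eE]; rewrite eE /= -leqNgt => me.
    by rewrite g0//= -xidx//; apply: mP me _.
  - apply: le_trans gk; apply: ler_sum_subset => e; last exact: g0.
    by rewrite inE => /andP[].
  - move=> F FE Fc; apply: leq_trans (subset_leq_card (subsetIr _ _)) _.
    by apply: cdH => //; apply: subset_trans FE (subsetDl _ _).
  - move=> v; rewrite !inE => /and3P[vB vc va]; apply: le_trans Ds _.
    (* Passing from [a] back to [g] loses at most [delta / 2] of this gap, so light edges must
       supply at least [delta / 2] at [v]. *)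
    have av : asum v <= 1 - delta.
      have asumE : asum v = \sum_(i <- [seq idx e | e <- enum (Hv v)]) a i.
        by rewrite big_map big_enum.
      rewrite asumE; apply: deltaP; last by rewrite -asumE.
      by rewrite size_map -cardE ltnW.
    have := near_asum v; rewrite ler_norml => /andP[_ gv].
    have mnd : mn <= delta / 2 by rewrite ge_min lexx.
    move: vB; rewrite (bigID (mem Hs)) /=.
    rewrite (eq_bigl (mem (Hv v))); last first.
      by move=> e; rewrite !inE; case: (e \in E); rewrite ?andbF// andbC.
    rewrite [X in _ + X](eq_bigl (fun e => (e \in E :\: Hs) && (v \in e))).
      by lra.
    by move=> e; rewrite in_setD andbC andbA.
pose B' := B1 :|: B2.
have card_B' : (#|B'| <= P)%N.
  apply: leq_trans (leq_card_setU _ _) _; apply: leq_add => //.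
  rewrite -(ler_nat R); apply: le_trans card_B2 _; apply/ltW/archi_boundP.
  by rewrite mulr_ge0// exprn_ge0// divr_ge0// ltW.
(* Vertices of [B'] are encoded by their positions in [enum B'], so that traces live in a type
   independent of [H]. *)
pose trace (e : {set vertex H}) := [set i : 'I_P |
  [exists v in B', (v \in e) && (index v (enum B') == i)]].
have traceP (e f : {set vertex H}) v : v \in B' -> v \in e -> trace e = trace f -> v \in f.
  move=> vB' ve ef.
  have iP : (index v (enum B') < P)%N.
    by apply: leq_trans card_B'; rewrite cardE index_mem mem_enum.
  have : Ordinal iP \in trace e.
    by rewrite inE; apply/exists_inP; exists v; rewrite ?ve/=.
  rewrite ef inE => /exists_inP[u uB' /andP[uf /eqP]] /=.
  move=> /(congr1 (nth v (enum B'))); rewrite !nth_index ?mem_enum//.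
  by move=> <-.
pose phi e : J := if insub (idx e) is Some i then inl i else inr (trace e).
(* For [v] in [B'] the trace decides whether a light edge contains [v], so all edges through [v] may
   be used; for the other covered vertices the heavy edges alone reach [1 - eta]. *)
pose A v := if v \in B' then [set e in E | v \in e] else Hv v.
have [v vB|nu [nu01 nuk nuB nuS]] := etaP _ E g phi B A g0 gk.
  split.
  - rewrite /A; case: ifP => _; last exact: subset_trans HsE.
    by apply/subsetP => e; rewrite inE => /andP[].
  - move=> e f; have AE u w : u \in A w -> u \in E.
      rewrite /A; case: ifP => _; first by rewrite inE => /andP[].
      by move=> /(subsetP (HvS w)) /(subsetP HsE).
    move=> eA fE; have eE := AE _ _ eA.
    rewrite /phi; case: insubP => [i _ ie|em]; case: insubP => [j _ jf|fm] //.
      by case=> ij; rewrite (idx_inj f e)// -ie -jf ij.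
    case=> ef; move: eA; rewrite /A; case: ifP => vB'; last first.
      by rewrite !inE (negbTE em) andbF.
    by rewrite !inE fE => /andP[_ ve]; apply: traceP ef.
  - by move=> e; rewrite /A; case: ifP => _; rewrite inE => /andP[].
  - rewrite /A; case: ifP => vB'; move: (vB); rewrite inE => gv.
      rewrite (eq_bigl (fun e => (e \in E) && (v \in e))) => [|e].
        by move: gv; lra.
      by rewrite inE.
    have av : 1 <= asum v.
      move: vB'; rewrite !inE => /negbT; rewrite negb_or -ltnNge.
      by rewrite gv /= negb_and => /andP[-> /=]; rewrite -leNgt.
    have := near_asum v; rewrite ler_norml => /andP[gv' _].
    have : mn <= eta by rewrite ge_min lexx orbT.
    by move: gv' av; lra.
exists nu; split=> //; last exact: leq_trans nJ.
by apply/subsetP => v /nuB; rewrite [in X in _ -> X]inE.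
Qed.

Theorem theorem3p1 (R : realType) :
  exists h : nat -> nat -> R -> nat,
    forall (c d : nat) (k : R), (1 <= c)%N ->
    forall H : hypergraph, cd_hypergraph c d H ->
    forall gamma : {set vertex H} -> R,
      edge_weighting gamma -> weight gamma <= k ->
    exists nu : {set vertex H} -> R,
      [/\ edge_weighting nu,
          weight nu <= k,
          covered gamma \subset covered nu
        & (#|weight_support nu| <= h c d k)%N].
Proof.
have /choice[h hP] (t : nat * nat * R) := bounded_support t.1.1 t.1.2 t.2.
by exists (fun c d k => h (c, d, k)) => c d k _; apply: (hP (c, d, k)).
Qed.
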